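(* Let $\mathscr{H}$ be a complex Hilbert space, $d\ge1$, and let $\mathbf{B}=(B_1,\ldots,B_d)$, $\mathbf{C}=(C_1,\ldots,C_d)\in\mathbb{B}^d(\mathscr{H})$. Then (i) $w_e(\mathbf{B}\mathbf{C})\le\sqrt{\frac12\left\|\sum_{k=1}^d\left(|B_k^*|^4+|C_k|^4\right)\right\|}$. (ii) $w_e(\mathbf{B}\mathbf{C})\le\sqrt{\frac12\|\mathbf{B}\mathbf{B}^*\|\|\mathbf{C}^*\mathbf{C}\|+\frac{\sqrt d}{2}w_e\left(\mathbf{B}(\mathbf{C}\mathbf{B})^*\mathbf{C}\right)}$. (iii) $w_e(\mathbf{B}\mathbf{C})\le\sqrt{\frac14\left\|\sum_{k=1}^d\left(|B_k^*|^4+|C_k|^4\right)\right\|+\frac{\sqrt d}{2}w_e\left(\mathbf{B}(\mathbf{C}\mathbf{B})^*\mathbf{C}\right)}$.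
   Context: $\mathbb{B}(\mathscr{H})$ is the algebra of bounded linear operators on the complex Hilbert space $\mathscr{H}$, and $\mathbb{B}^d(\mathscr{H})$ is the set of $d$-tuples of such operators. For $T\in\mathbb{B}(\mathscr{H})$, $|T|=(T^*T)^{1/2}$ and $\|T\|$ is the operator norm. For $\mathbf{T}=(T_1,\ldots,T_d)$, the Euclidean operator radius is $w_e(\mathbf{T})=\sup\{(\sum_{k=1}^d|\langle T_kx,x\rangle|^2)^{1/2}:\|x\|=1\}$ and the Euclidean operator norm is $\|\mathbf{T}\|=\sup\{(\sum_{k=1}^d\|T_kx\|^2)^{1/2}:\|x\|=1\}$. Products and adjoints of tuples are componentwise, e.g. $\mathbf{B}\mathbf{C}=(B_1C_1,\ldots,B_dC_d)$, and $\mathbf{B}(\mathbf{C}\mathbf{B})^*\mathbf{C}$ has $k$-th component $B_k(C_kB_k)^*C_k$. *)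

(* Defs.v *)
From HB Require Import structures.
From mathcomp Require Import all_boot all_order all_algebra.
From mathcomp Require Import complex sesquilinear.
From mathcomp Require Import boolp classical_sets functions reals.
From mathcomp Require Import topology normedtype.

Set Implicit Arguments.
Unset Strict Implicit.
Unset Printing Implicit Defensive.

Import Order.TTheory GRing.Theory Num.Theory.
Import numFieldNormedType.Exports.

Local Open Scope classical_set_scope.
Local Open Scope ring_scope.

(* [bounded_near T (nbhs 0)] is the library's boundedness of linear maps; see
   [linear_boundedP] for the equivalence with `|T x| <= r * `|x|. *)
Record bounded_op (K : numFieldType) (V : normedModType K) := BoundedOp {
  bop_fun :> {linear V -> V};
  bop_bounded : bounded_near bop_fun (nbhs (0 : V)) }.

Section BoundedOperatorRing.
Context {K : numFieldType} {V : normedModType K}.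
Implicit Types S T U : bounded_op V.

HB.instance Definition _ := gen_eqMixin (bounded_op V).
HB.instance Definition _ := gen_choiceMixin (bounded_op V).

Lemma bop_continuous T : continuous T.
Proof. exact/linear_bounded_continuous/bop_bounded. Qed.

Lemma bop_ext S T : S =1 T -> S = T.
Proof.
case: S T => [S Sb] [T Tb] /= /funext ST.
have {ST} ? : S = T.
  case: S T ST {Sb Tb} => [s [[a] [b]]] [t [[a'] [b']]] /= st.
  case: _ / st in a' b' *; congr (GRing.Linear.Pack (GRing.Linear.Class _ _)).
    by congr (GRing.isNmodMorphism.Axioms_ _); exact: Prop_irrelevance.
  by congr (GRing.isScalable.Axioms_ _); exact: Prop_irrelevance.
by subst T; congr BoundedOp; exact: Prop_irrelevance.
Qed.

Let continuous_bounded (f : {linear V -> V}) :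
  continuous f -> bounded_near f (nbhs (0 : V)).
Proof. by move/linear_bounded_continuous. Qed.

Fact bop_zero_bounded : bounded_near (\0 : {linear V -> V}) (nbhs (0 : V)).
Proof. by apply: continuous_bounded => x; exact: cst_continuous. Qed.
Definition bop_zero : bounded_op V := BoundedOp bop_zero_bounded.

Fact bop_opp_bounded T :
  bounded_near (\- T : {linear V -> V}) (nbhs (0 : V)).
Proof.
by apply: continuous_bounded => x; apply: cvgN; exact: bop_continuous.
Qed.
Definition bop_opp T : bounded_op V := BoundedOp (bop_opp_bounded T).

Fact bop_add_bounded S T :
  bounded_near (S \+ T : {linear V -> V}) (nbhs (0 : V)).
Proof.
by apply: continuous_bounded => x; apply: cvgD; exact: bop_continuous.
Qed.
Definition bop_add S T : bounded_op V := BoundedOp (bop_add_bounded S T).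

Fact bop_id_bounded : bounded_near (idfun : {linear V -> V}) (nbhs (0 : V)).
Proof. by apply: continuous_bounded => x; exact: cvg_id. Qed.
Definition bop_id : bounded_op V := BoundedOp bop_id_bounded.

Fact bop_comp_bounded S T :
  bounded_near (S \o T : {linear V -> V}) (nbhs (0 : V)).
Proof.
apply: continuous_bounded => x.
by apply: continuous_comp; exact: bop_continuous.
Qed.
Definition bop_comp S T : bounded_op V := BoundedOp (bop_comp_bounded S T).

Fact bop_addA : associative bop_add.
Proof. by move=> S T U; apply: bop_ext => x /=; rewrite addrA. Qed.
Fact bop_addC : commutative bop_add.
Proof. by move=> S T; apply: bop_ext => x /=; rewrite addrC. Qed.
Fact bop_add0 : left_id bop_zero bop_add.
Proof. by move=> T; apply: bop_ext => x /=; rewrite add0r. Qed.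
Fact bop_addN : left_inverse bop_zero bop_opp bop_add.
Proof. by move=> T; apply: bop_ext => x /=; rewrite addNr. Qed.

HB.instance Definition _ := GRing.isZmodule.Build (bounded_op V)
  bop_addA bop_addC bop_add0 bop_addN.

Fact bop_compA : associative bop_comp.
Proof. by move=> S T U; apply: bop_ext. Qed.
Fact bop_comp1l : left_id bop_id bop_comp.
Proof. by move=> T; apply: bop_ext. Qed.
Fact bop_comp1r : right_id bop_id bop_comp.
Proof. by move=> T; apply: bop_ext. Qed.
Fact bop_compDl : left_distributive bop_comp bop_add.
Proof. by move=> S T U; apply: bop_ext. Qed.
Fact bop_compDr : right_distributive bop_comp bop_add.
Proof. by move=> S T U; apply: bop_ext => x /=; rewrite linearD. Qed.

(* Not required to be non-trivial, since V may be the zero space. *)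
HB.instance Definition _ := GRing.Zmodule_isPzRing.Build (bounded_op V)
  bop_compA bop_comp1l bop_comp1r bop_compDl bop_compDr.

Lemma bopDE S T x : (S + T) x = S x + T x. Proof. by []. Qed.
Lemma bopME S T x : (S * T) x = S (T x). Proof. by []. Qed.

End BoundedOperatorRing.

(* The inner product is linear in its first argument and conjugate-linear in
   the second. *)
Record hilbertSpace (R : realType) := HilbertSpace {
  hilbert_sort :> completeNormedModType R[i];
  hdot : {dot hilbert_sort for Num.conj};
  hdot_norm : forall x : hilbert_sort, `|x| ^+ 2 = hdot x x }.

Section HilbertOperators.
Context {R : realType} {H : hilbertSpace R}.
Implicit Types S T : bounded_op H.

Local Notation "''[' x , y ]" := (hdot H x y) : ring_scope.

(* The norms of R[i] and of H take their values in R[i]; their real part is the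
   usual real-valued norm. *)
Definition rnorm {V : normedZmodType R[i]} (x : V) : R := complex.Re `|x|.

Definition unit_sphere : set H := [set x | `|x| = 1].

(* Such an S exists by Riesz's theorem, and it is unique. *)
Definition adjoint T : bounded_op H :=
  xget 0 [set S : bounded_op H | forall x y, '[T x, y] = '[x, S y]].

(* In R[i], 0 <= z means that z is real and nonnegative. *)
Definition positive_op S : Prop := forall x, 0 <= '[S x, x].

(* The unique positive square root of T^* T. *)
Definition opabs T : bounded_op H :=
  xget 0 [set S : bounded_op H | positive_op S /\ S ^+ 2 = adjoint T * T].

(* In the zero space the unit sphere is empty, and the suprema below are
   [sup set0 = 0]. *)
Definition opnorm T : R := sup [set rnorm (T x) | x in unit_sphere].

Definition euclidean_opnorm d (T : 'I_d -> bounded_op H) : R :=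
  sup [set Num.sqrt (\sum_(k < d) rnorm (T k x) ^+ 2) | x in unit_sphere].

Definition euclidean_opradius d (T : 'I_d -> bounded_op H) : R :=
  sup [set Num.sqrt (\sum_(k < d) rnorm '[T k x, x] ^+ 2) | x in unit_sphere].

End HilbertOperators.

(* Main.v *)
Require Import Defs.
From HB Require Import structures.
From mathcomp Require Import all_boot all_order all_algebra.
From mathcomp Require Import complex sesquilinear.
From mathcomp Require Import boolp classical_sets functions reals.
From mathcomp Require Import topology normedtype.
From mathcomp Require Import ring lra.

Import Order.TTheory GRing.Theory Num.Theory.
Import numFieldNormedType.Exports.

Local Open Scope ring_scope.

(** For a unit vector [x], write [P = C_k^* C_k] and [Q = B_k B_k^*]. By the
    Cauchy-Schwarz inequality,
      [|<B_k C_k x, x>|^2 = |<C_k x, B_k^* x>|^2 <= <P x, x> <x, Q x>],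
    and Buzano's inequality ([buzano]) bounds the right side by
      [(|P x| |Q x| + |<P x, Q x>|) / 2],
    where [<P x, Q x> = <B_k (C_k B_k)^* C_k x, x>].

    The three bounds follow by summing over [k]. For (i), both terms of
    the bound are at most [(|P x|^2 + |Q x|^2) / 2], and
    [|P x|^2 + |Q x|^2 = <(|C_k|^4 + |B_k^*|^4) x, x>] because [|T|^4] is the
    square of [T^* T] ([hdot_opabs4]). For (ii), the finite Cauchy-Schwarz
    inequality ([ler_sum_cauchy]) is applied to the sum of the [|P x| |Q x|];
    applied to the sum of the [|<P x, Q x>|] against the constant 1 it produces
    the factor [sqrt d]. For (iii), the first sum is treated as in (i) and the
    second one as in (ii).

    As the adjoint and the absolute value are defined by choice, the argument
    rests on their existence. The adjoint comes from Riesz's theorem, proved by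
    minimising a quadratic functional ([riesz]). The square root of [T^* T] is
    reduced by scaling to [(1 - Z)^2 = 1 - B] for a self-adjoint contraction
    [B], and [Z] is the limit of the iteration [Z := (B + Z^2) / 2]. Its
    convergence is controlled by the same iteration on the real number
    [B = 1], so that neither spectral theory nor power series are involved
    ([contraction_fixpoint], [opabs_exists]). *)

(** * Real-valued norm and inner product *)

Section RealNorm.
Context {R : realType} {V : normedZmodType R[i]}.
Implicit Types x y z : V.

Lemma normr_rnorm x : `|x| = (rnorm x)%:C%C.
Proof. by rewrite /rnorm RRe_real ?normr_real. Qed.

Lemma rnorm_ge0 x : 0 <= rnorm x.
Proof. by rewrite -ler0c -normr_rnorm. Qed.

Lemma rnorm_real_complex (r : R) : rnorm (r%:C%C : R[i]) = `|r|.
Proof. by rewrite /rnorm normc_def /= expr0n addr0 sqrtr_sqr. Qed.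

Lemma rnorm0 : rnorm (0 : V) = 0.
Proof. by rewrite /rnorm normr0. Qed.

Lemma rnorm_eq0 x : rnorm x = 0 -> x = 0.
Proof. by move=> x0; apply/normr0_eq0; rewrite normr_rnorm x0. Qed.

Lemma rnormN x : rnorm (- x) = rnorm x.
Proof. by rewrite /rnorm normrN. Qed.

Lemma rnormBC x y : rnorm (x - y) = rnorm (y - x).
Proof. by rewrite /rnorm distrC. Qed.

Lemma ler_rnormD x y : rnorm (x + y) <= rnorm x + rnorm y.
Proof. by rewrite -lecR rmorphD/= -!normr_rnorm ler_normD. Qed.

Lemma ler_rnormB x y : rnorm (x - y) <= rnorm x + rnorm y.
Proof. by rewrite -(rnormN y) ler_rnormD. Qed.

Lemma ler_rnormB_trans x y z :
  rnorm (x - z) <= rnorm (x - y) + rnorm (y - z).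
Proof. by rewrite -[x - z](subrKA y) ler_rnormD. Qed.

End RealNorm.

Section Modulus.
Context {R : realType}.
Implicit Types a b : R[i].

Lemma rnormZ (V : normedModType R[i]) a (x : V) :
  rnorm (a *: x) = rnorm a * rnorm x.
Proof. by apply: complexI; rewrite rmorphM/= -!normr_rnorm normrZ. Qed.

Lemma rnormcM a b : rnorm (a * b) = rnorm a * rnorm b.
Proof. by apply: complexI; rewrite rmorphM/= -!normr_rnorm normrM. Qed.

Lemma rnorm_conj a : rnorm a^*%C = rnorm a.
Proof. by rewrite /rnorm normcJ. Qed.

Lemma real_complexD (r s : R) : (r + s)%:C%C = r%:C%C + s%:C%C :> R[i].
Proof. exact: rmorphD. Qed.

Lemma addcJ_Re a : a + a^*%C = (2 * complex.Re a)%:C%C.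
Proof. by rewrite addcJ rmorphM rmorph_nat. Qed.

Lemma rnorm_nat n : rnorm (n%:R : R[i]) = n%:R.
Proof.
by rewrite -(rmorph_nat (real_complex R)) rnorm_real_complex ger0_norm.
Qed.

Lemma mulcJ_rnorm a : a * a^*%C = (rnorm a ^+ 2)%:C%C.
Proof. by rewrite -sqr_normc normr_rnorm rmorphXn. Qed.

End Modulus.

Section Dot.
Context {R : realType} {H : hilbertSpace R}.
Implicit Types (x y z : H) (a : R[i]).
Local Notation "''[' x , y ]" := (hdot H x y) : ring_scope.

Lemma hdotC x y : '[x, y] = ('[y, x])^*%C.
Proof. by rewrite [LHS]hermC expr0 mul1r. Qed.

Lemma hdotDl x y z : '[x + y, z] = '[x, z] + '[y, z].
Proof. by rewrite linearDl. Qed.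

Lemma hdotDr x y z : '[z, x + y] = '[z, x] + '[z, y].
Proof. by rewrite linearD. Qed.

Lemma hdotBl x y z : '[x - y, z] = '[x, z] - '[y, z].
Proof. by rewrite linearBl. Qed.

Lemma hdotBr x y z : '[z, x - y] = '[z, x] - '[z, y].
Proof. by rewrite linearB. Qed.

Lemma hdotZl a x y : '[a *: x, y] = a * '[x, y].
Proof. by rewrite linearZl. Qed.

Lemma hdotZr a x y : '[x, a *: y] = a^*%C * '[x, y].
Proof. by rewrite linearZ. Qed.

Lemma hdotxx x : '[x, x] = (rnorm x ^+ 2)%:C%C.
Proof. by rewrite -hdot_norm normr_rnorm rmorphXn. Qed.

(** Polarisation: together with the triangle inequality of [H], it gives the
    real part of the Cauchy-Schwarz inequality. *)
Lemma rnorm_sqrD x y : rnorm (x + y) ^+ 2 =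
  rnorm x ^+ 2 + rnorm y ^+ 2 + 2 * complex.Re '[x, y].
Proof.
apply: complexI; rewrite -hdotxx hdotDl !hdotDr !hdotxx [hdot H y x]hdotC.
by rewrite 2!real_complexD -addcJ_Re; ring.
Qed.

Lemma rnorm_sqrB x y : rnorm (x - y) ^+ 2 =
  rnorm x ^+ 2 + rnorm y ^+ 2 - 2 * complex.Re '[x, y].
Proof.
rewrite rnorm_sqrD rnormN -scaleN1r hdotZr rmorphN rmorph1 mulN1r.
by case: '[x, y] => u v /=; rewrite mulrN.
Qed.

Lemma ler_Re_hdot x y : complex.Re '[x, y] <= rnorm x * rnorm y.
Proof.
have := rnorm_sqrD x y; have := ler_rnormD x y.
have := rnorm_ge0 x; have := rnorm_ge0 y; have := rnorm_ge0 (x + y).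
nra.
Qed.

(** The bound on real parts becomes a bound on the modulus once [x] is rotated
    by the phase of [<x, y>]. *)
Lemma ler_hdot x y : rnorm '[x, y] <= rnorm x * rnorm y.
Proof.
set c := '[x, y]; have := ler_Re_hdot (c^*%C *: x) y.
rewrite hdotZl mulrC mulcJ_rnorm rnormZ rnorm_conj /= => le_c.
have [->|c_neq0] := eqVneq (rnorm c) 0; first by rewrite mulr_ge0 ?rnorm_ge0.
have c_gt0 : 0 < rnorm c by rewrite lt0r c_neq0 rnorm_ge0.
by rewrite -(ler_pM2l c_gt0) mulrA -expr2.
Qed.

(** Buzano's inequality. The vector [2 <x, e> e - x] is the reflection of [x]
    in the line spanned by [e], so it has the norm of [x]; its inner product
    with [y] is [2 <x, e> <e, y> - <x, y>], to which Cauchy-Schwarz applies. *)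
Lemma buzano x y e : rnorm e = 1 ->
  rnorm '[x, e] * rnorm '[e, y] <=
    (rnorm x * rnorm y + rnorm '[x, y]) / 2.
Proof.
move=> e1; pose p := 2 *: ('[x, e] *: e) - x.
have normp : rnorm p = rnorm x.
  apply/eqP; rewrite -(@eqrXn2 _ 2) ?rnorm_ge0//; apply/eqP.
  rewrite rnorm_sqrB hdotZl hdotZl [hdot H e x]hdotC mulcJ_rnorm !rnormZ e1.
  rewrite rnorm_nat.
  by rewrite -(rmorph_nat (real_complex R)) -rmorphM/=; ring.
have : 2 * ('[x, e] * '[e, y]) = '[p, y] + '[x, y].
  by rewrite hdotBl !hdotZl; ring.
move=> /(congr1 rnorm); rewrite !rnormcM rnorm_nat.
have := ler_rnormD '[p, y] '[x, y]; have := ler_hdot p y.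
by rewrite normp => ? ? ?; lra.
Qed.
End Dot.

(** * Completeness with an explicit rate *)

Section Vanishing.
Context {R : realType}.
Implicit Types e : nat -> R.

(** Asking for one small term rather than for a limit is enough here, because
    the error bounds below are required at every index. *)
Definition vanishing e := forall eps : R, 0 < eps -> exists n, e n < eps.

Lemma vanishing_le0 e (r c : R) : vanishing e -> 0 <= c ->
  (forall n, r <= c * e n) -> r <= 0.
Proof.
move=> e0 c0 re; rewrite leNgt; apply/negP => r0.
have c1 : 0 < c + 1 by rewrite ltr_wpDl.
have [n] := e0 _ (divr_gt0 r0 c1); rewrite ltr_pdivlMr// => en.
have := re n; have [en0|en0] := lerP 0 (e n); first by lra.
by have := mulr_ge0_le0 c0 (ltW en0); lra.
Qed.

(** This sequence decreases no faster than the recursion [t - t ^ 2 / 2] does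
    ([rate_step]), which is the recursion met in the construction of square
    roots; it also serves as the error bound for Riesz's theorem. *)
Definition rate (n : nat) : R := 2 / n.+2%:R.

Lemma rate_gt0 n : 0 < rate n.
Proof. by rewrite divr_gt0. Qed.

Lemma rate_le1 n : rate n <= 1.
Proof. by rewrite ler_pdivrMr// mul1r ler_nat. Qed.

Lemma rate_anti m n : (m <= n)%N -> rate n <= rate m.
Proof. by move=> mn; rewrite ler_pM2l// lef_pV2 ?posrE// ler_nat !ltnS. Qed.

Lemma rate_step n : rate n - rate n ^+ 2 / 2 <= rate n.+1.
Proof.
rewrite /rate -(subr_ge0 (_ - _)).
have -> : n.+3%:R = n.+2%:R + 1 :> R by rewrite -natr1.
have n0 : 0 < n.+2%:R :> R by [].
move: (n.+2%:R) n0 => s s0.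
have -> : 2 / (s + 1) - (2 / s - (2 / s) ^+ 2 / 2) = 2 / (s ^+ 2 * (s + 1)).
  by field; rewrite !gt_eqF// addr_gt0.
by rewrite divr_ge0// mulr_ge0// ?exprn_ge0// ?addr_ge0// ltW.
Qed.

Lemma rate_vanishing : vanishing rate.
Proof.
move=> eps eps0; exists (Num.truncn (2 / eps)).
rewrite /rate ltr_pdivrMr// mulrC -ltr_pdivrMr//.
by rewrite (lt_trans (truncnS_gt _))// ltr_nat.
Qed.

End Vanishing.

Section Complete.
Context {R : realType} {H : hilbertSpace R}.
Implicit Types (u : nat -> H) (x y : H).
Local Open Scope classical_set_scope.

(** The completeness of [H] in quantitative form: an a priori bound on the
    tails of [u] is inherited by the distance to the limit, so that no further
    filter reasoning is needed. *)
Lemma cauchy_rate u (e : nat -> R) : vanishing e ->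
  (forall n m, (n <= m)%N -> rnorm (u m - u n) <= e n) ->
  exists l, forall n, rnorm (l - u n) <= e n.
Proof.
move=> e0 ue.
have /cauchy_cvgP/cvg_ex[l ul] : cauchy (u @ \oo).
  apply: cauchy_exP => eps eps0.
  have epsE : (complex.Re eps)%:C%C = eps by rewrite RRe_real ?gtr0_real.
  have [|n en] := e0 (complex.Re eps); first by rewrite -ltcR epsE.
  exists (u n); exists n => // m /= nm; rewrite -ball_normE /= distrC.
  by rewrite normr_rnorm -epsE ltcR (le_lt_trans (ue _ _ nm)).
exists l => n; rewrite leNgt; apply/negP => lun.
have d0 : 0 < (rnorm (l - u n) - e n)%:C%C by rewrite ltcR subr_gt0.
have /cvgrPdist_lt/(_ _ d0)[N _ /(_ (maxn N n) (leq_maxl _ _))] := ul.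
rewrite normr_rnorm ltcR ltNge => /negP; apply.
rewrite lerBlDl (le_trans (ler_rnormB_trans _ (u (maxn N n)) _))//.
by rewrite [leLHS]addrC lerD2r ue// leq_maxr.
Qed.

(** Packages a map obtained by choice, such as an adjoint or a pointwise limit,
    as an operator. *)
Lemma exists_bounded_op (f : H -> H) (M : R) : linear f ->
  (forall x, rnorm (f x) <= M * rnorm x) -> exists T : bounded_op H, T =1 f.
Proof.
move=> lf fM.
pose L : {linear H -> H} :=
  HB.pack f (GRing.isLinear.Build R[i] H H *:%R f lf).
have Lb : bounded_near L (nbhs (0 : H)).
  apply/linear_boundedP; exists M%:C%C; split.
    by apply/complex_realP; exists M.
  move=> r Mr x /=; rewrite (le_trans _ (ler_wpM2r (normr_ge0 _) (ltW Mr)))//.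
  by rewrite !normr_rnorm -rmorphM lecR fM.
by exists (BoundedOp Lb).
Qed.

Lemma bounded_op_bound (T : bounded_op H) :
  exists2 M : R, 0 < M & forall x, rnorm (T x) <= M * rnorm x.
Proof.
have /linear_boundedP/pinfty_ex_gt0[M M0 TM] := bop_bounded T.
have ME : (complex.Re M)%:C%C = M by rewrite RRe_real ?gtr0_real.
exists (complex.Re M) => [|x]; first by rewrite -ltcR ME.
by have := TM x; rewrite -{1}ME !normr_rnorm -rmorphM lecR.
Qed.
End Complete.

(** * Riesz representation and adjoints *)

Section Riesz.
Context {R : realType} {H : hilbertSpace R}.
Implicit Types (x y z : H) (a b : R[i]).
Local Notation "''[' x , y ]" := (hdot H x y) : ring_scope.

Lemma Re_realM (r : R) a : complex.Re (r%:C%C * a) = r * complex.Re a.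
Proof. by case: a => u v /=; rewrite mul0r subr0. Qed.

Lemma ReD a b : complex.Re (a + b) = complex.Re a + complex.Re b.
Proof. by case: a b => ? ? []. Qed.

Lemma parallelogram x y :
  rnorm (x + y) ^+ 2 + rnorm (x - y) ^+ 2 = 2 * (rnorm x ^+ 2 + rnorm y ^+ 2).
Proof. by rewrite rnorm_sqrD rnorm_sqrB; ring. Qed.

Lemma hdot_inj y z : (forall x, '[x, y] = '[x, z]) -> y = z.
Proof.
move=> yz; apply/eqP; rewrite -subr_eq0; apply/eqP/rnorm_eq0/eqP.
rewrite -(sqrf_eq0 (rnorm _)); apply/eqP/complexI.
by rewrite -hdotxx hdotBr yz subrr.
Qed.

(** [z] is the minimiser of [J x = |x|^2 - 2 Re (f x)]: completing the square,
    [J x = |x - z|^2 - |z|^2] whenever [f] is represented by [z]. By the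
    parallelogram law a minimising sequence is Cauchy. Minimality gives
    [Re (g w) <= |w|^2 / 2] for the error [g] of the representation; as the
    left side is of first order in [w] and the right side of second order,
    [g] vanishes. *)
Lemma riesz (f : H -> R[i]) (M : R) :
  (forall a x y, f (a *: x + y) = a * f x + f y) ->
  (forall x, rnorm (f x) <= M * rnorm x) -> exists z, forall x, f x = '[x, z].
Proof.
move=> flin fM.
have fD x y : f (x + y) = f x + f y by rewrite -[x in LHS]scale1r flin mul1r.
have f0 : f 0 = 0 by apply: (addrI (f 0)); rewrite -fD !addr0.
have fZ a x : f (a *: x) = a * f x by rewrite -[a *: x]addr0 flin f0 addr0.
pose J x := rnorm x ^+ 2 - 2 * complex.Re (f x).
have JB x : - M ^+ 2 <= J x.
  have : complex.Re (f x) <= M * rnorm x.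
    rewrite (le_trans _ (fM x))// (le_trans (ler_norm _))//.
    by rewrite -lecR -normr_rnorm normc_ge_Re.
  by have := sqr_ge0 (rnorm x - M); rewrite /J; nra.
pose E := [set J x | x in setT]%classic.
have infE : has_inf E.
  by split; [exists (J 0), 0|exists (- M ^+ 2) => _ [x _ <-]].
have mJ x : inf E <= J x by apply: ge_inf; [exact: infE.2|exists x].
have [|u uJ] := @choice _ _ (fun n x => J x < inf E + (rate n / 2) ^+ 2).
  move=> n; have d0 : 0 < (rate n / 2 : R) ^+ 2.
    by rewrite exprn_gt0// divr_gt0// rate_gt0.
  by have [_ [x _ <-] xJ] := inf_adherent d0 infE; exists x.
have [n m nm|z zu] := @cauchy_rate _ H u rate rate_vanishing.
  (* [J] at the midpoint, where it is at least the infimum. *)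
  have Jmid : 4 * J (2^-1 *: (u n + u m)) =
      rnorm (u m + u n) ^+ 2 - 4 * complex.Re (f (u n))
      - 4 * complex.Re (f (u m)).
    have -> : 2^-1 = (2^-1 : R)%:C%C by rewrite fmorphV rmorph_nat.
    rewrite /J rnormZ fZ fD [u n + u m]addrC rnorm_real_complex Re_realM ReD.
    by rewrite ger0_norm ?invr_ge0//=; field.
  have := parallelogram (u m) (u n); have := mJ (2^-1 *: (u n + u m)).
  have := uJ n; have := uJ m; have := @rate_anti R _ _ nm.
  have := @rate_gt0 R m; have := @rate_gt0 R n.
  rewrite -(@ler_pXn2r _ 2) ?nnegrE ?rnorm_ge0// ?(ltW (rate_gt0 _))//.
  move: Jmid; rewrite /J; nra.
pose g x := f x - '[x, z].
(* Compare [J] at [u n] and at [u n + w], then let [n] grow. *)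
have gle w : complex.Re (g w) <= rnorm w ^+ 2 / 2.
  rewrite -subr_le0.
  apply: (@vanishing_le0 _ rate _ (rnorm w + 1)) => [||n].
  - exact: rate_vanishing.
  - by rewrite addr_ge0// rnorm_ge0.
  have := mJ (u n + w); have := uJ n; have := ler_Re_hdot w (u n - z).
  rewrite /J /g fD rnorm_sqrD hdotBr !raddfB/= !raddfD/=.
  rewrite [hdot H (u n) w]hdotC -[in X in X -> _](rnormBC z).
  have := ler_wpM2l (rnorm_ge0 w) (zu n).
  have := @rate_gt0 R n; have := @rate_le1 R n.
  case: '[w, u n] => /= ? ?.
  nra.
exists z => h; apply/eqP; rewrite -subr_eq0; apply/eqP/rnorm_eq0.
rewrite -/(g h); apply/eqP/negPn/negP => gh.
have gh0 : 0 < rnorm (g h) by rewrite lt0r gh rnorm_ge0.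
(* Test [gle] on a small multiple of [h], with the phase that makes [g w]
   real and positive; any [t] with [t * |h|^2 < 2] does. *)
pose t : R := (rnorm h ^+ 2 + 1)^-1.
have := gle ((t%:C%C * (g h)^*%C) *: h).
rewrite /g fZ hdotZl -mulrBr -/(g h) -mulrA.
rewrite [_^*%C * _]mulrC mulcJ_rnorm -rmorphM /=.
rewrite rnormZ rnormcM rnorm_conj rnorm_real_complex.
have t0 : 0 < t by rewrite invr_gt0 ltr_wpDl// exprn_ge0// rnorm_ge0.
have t1 : t * (rnorm h ^+ 2 + 1) = 1.
  by rewrite mulVf// gt_eqF// ltr_wpDl// exprn_ge0// rnorm_ge0.
rewrite ger0_norm ?(ltW t0)// !exprMn leNgt => /negP; apply.
have -> : t ^+ 2 * rnorm (g h) ^+ 2 * rnorm h ^+ 2 / 2 =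
    t * rnorm (g h) ^+ 2 * (t * rnorm h ^+ 2 / 2) by ring.
by rewrite gtr_pMr ?mulr_gt0 ?exprn_gt0//; lra.
Qed.

(** Both maps are arbitrary functions, so that the bound is available while
    the adjoint is still under construction. *)
Lemma rnorm_formal_adjoint (T S : H -> H) (M : R) :
  (forall x, rnorm (T x) <= M * rnorm x) ->
  (forall x y, '[T x, y] = '[x, S y]) ->
  forall y, rnorm (S y) <= M * rnorm y.
Proof.
move=> TM TS y; have [Sy0|Sy0] := eqVneq (rnorm (S y)) 0.
  have [y0|y0] := eqVneq (rnorm y) 0; first by rewrite Sy0 y0 mulr0.
  by rewrite Sy0 (le_trans (rnorm_ge0 _) (TM y)).
have Sy : 0 < rnorm (S y) by rewrite lt0r Sy0 rnorm_ge0.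
have := ler_Re_hdot (T (S y)) y; rewrite TS hdotxx /= expr2 => Syle.
by rewrite -(ler_pM2r Sy) (le_trans Syle)// mulrAC ler_wpM2r ?rnorm_ge0.
Qed.

Lemma adjoint_exists (T : bounded_op H) :
  exists S : bounded_op H, forall x y, '[T x, y] = '[x, S y].
Proof.
have [M M0 TM] := bounded_op_bound T.
have [y|S TS] := @choice _ _ (fun y z => forall x, '[T x, y] = '[x, z]).
  apply: (@riesz (fun x => '[T x, y]) (M * rnorm y)).
    by move=> a x x'; rewrite linearP hdotDl hdotZl.
  move=> x; rewrite (le_trans (ler_hdot _ _))// mulrAC ler_wpM2r ?rnorm_ge0//.
have Slin : linear S.
  move=> a x y; apply: hdot_inj => w.
  by rewrite hdotDr hdotZr -!TS hdotDr hdotZr.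
have [|S' S'E] := @exists_bounded_op _ H S M Slin; last first.
  by exists S' => x y; rewrite S'E TS.
exact: (rnorm_formal_adjoint _ _ _ TM (fun x y => TS y x)).
Qed.

Lemma hdot_adjointr (T : bounded_op H) x y : '[T x, y] = '[x, adjoint T y].
Proof. exact: (xgetPex 0 (adjoint_exists T)). Qed.

Lemma hdot_adjointl (T : bounded_op H) x y : '[adjoint T x, y] = '[x, T y].
Proof. by rewrite hdotC -hdot_adjointr -hdotC. Qed.

Lemma adjointK (T : bounded_op H) : adjoint (adjoint T) = T.
Proof.
apply: bop_ext => y; apply: hdot_inj => x.
by rewrite -hdot_adjointr hdot_adjointl.
Qed.

End Riesz.

(** * Square roots of positive operators *)

Section SquareRoot.
Context {R : realType} {H : hilbertSpace R}.
Implicit Types (x y z : H) (a : R[i]).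
Local Notation "''[' x , y ]" := (hdot H x y) : ring_scope.

(** Picard iteration for [2 Z = B + Z^2], that is for [(1 - Z)^2 = 1 - B]. *)
Fixpoint picard (B : H -> H) (n : nat) (x : H) : H :=
  if n is m.+1 then 2^-1 *: (B x + picard B m (picard B m x)) else 0.

Lemma rnorm_half x : rnorm (2^-1 *: x) = rnorm x / 2.
Proof.
have -> : 2^-1 = (2^-1 : R)%:C%C by rewrite fmorphV rmorph_nat.
by rewrite rnormZ rnorm_real_complex ger0_norm ?invr_ge0// mulrC.
Qed.

Section Contraction.
Variable B : H -> H.
Hypothesis B_linear : linear B.
Hypothesis B_contr : forall x, rnorm (B x) <= rnorm x.
Hypothesis B_sym : forall x y, '[B x, y] = '[x, B y].

Local Notation Y := (picard B).

Lemma picard_linear n : linear (Y n).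
Proof.
elim: n => [|n IHn] a x y /=; first by rewrite scaler0 addr0.
by rewrite B_linear !IHn !scalerDr !scalerA [2^-1 * a]mulrC addrACA.
Qed.

Lemma picardB n x y : Y n (x - y) = Y n x - Y n y.
Proof. by rewrite -scaleN1r addrC picard_linear scaleN1r addrC. Qed.

Lemma picard_sym n x y : '[Y n x, y] = '[x, Y n y].
Proof.
elim: n x y => [|n IHn] x y /=; first by rewrite linear0l linear0r.
rewrite hdotZl hdotZr hdotDl hdotDr B_sym !IHn.
by rewrite fmorphV rmorph_nat.
Qed.

(** [1 - gap n] is the same iteration for the scalar [B = 1], namely
    [a 0 = 0] and [a n.+1 = (1 + (a n)^2) / 2]. It majorises the operator
    iteration, and it increases to the fixed point 1. *)
Fixpoint gap (n : nat) : R :=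
  if n is m.+1 then gap m - gap m ^+ 2 / 2 else 1.

Lemma gap_itv n : 0 <= gap n <= 1.
Proof.
elim: n => [|n /andP[g0 g1]] /=; first by rewrite ler01 lexx.
by apply/andP; split; nra.
Qed.

Lemma gap_le_rate n : gap n <= rate n.
Proof.
elim: n => [|n IHn] /=; first by rewrite /rate divff ?pnatr_eq0.
rewrite (le_trans _ (rate_step n))//.
have := @rate_le1 R n; have /andP[_] := gap_itv n.
move: (gap n) (rate n) IHn => g r gr g1 r1; nra.
Qed.

Lemma gap_vanishing : vanishing gap.
Proof.
move=> eps /rate_vanishing[n neps]; exists n.
exact: le_lt_trans (gap_le_rate n) neps.
Qed.

Lemma picard_le n x : rnorm (Y n x) <= (1 - gap n) * rnorm x.
Proof.
elim: n x => [|n IHn] x /=; first by rewrite rnorm0 subrr mul0r.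
rewrite rnorm_half; have := ler_rnormD (B x) (Y n (Y n x)).
have := B_contr x; have := IHn (Y n x).
have /andP[g0 g1] := gap_itv n.
have := ler_wpM2l (_ : 0 <= 1 - gap n) (IHn x); rewrite subr_ge0 => /(_ g1).
nra.
Qed.

(** The difference of two squares of iterates is split as
    [V (V - W) + (V - W) W], which does not require [V] and [W] to commute. *)
Lemma picard_step n x :
  rnorm (Y n.+1 x - Y n x) <= (gap n - gap n.+1) * rnorm x.
Proof.
elim: n x => [|n IHn] x.
  rewrite /= subr0 rnorm_half addr0; have := B_contr x; nra.
have -> : Y n.+2 x - Y n.+1 x =
    2^-1 *: (Y n.+1 (Y n.+1 x - Y n x) + (Y n.+1 (Y n x) - Y n (Y n x))).
  rewrite picardB subrKA.
  transitivity (2^-1 *: (B x + Y n.+1 (Y n.+1 x)) -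
                2^-1 *: (B x + Y n (Y n x))).
    by [].
  by rewrite -scalerBr [B x + Y n.+1 _]addrC addrKA.
rewrite rnorm_half.
have := ler_rnormD (Y n.+1 (Y n.+1 x - Y n x)) (Y n.+1 (Y n x) - Y n (Y n x)).
have := picard_le n.+1 (Y n.+1 x - Y n x); have := IHn (Y n x).
have /andP[_ h1] := gap_itv n.+1.
have hg : 0 <= gap n - gap n.+1.
  by rewrite /= opprB addrC subrK divr_ge0// sqr_ge0.
have h1' : 0 <= 1 - gap n.+1 by rewrite subr_ge0.
have := ler_wpM2l h1' (IHn x); have := ler_wpM2l hg (picard_le n x).
rewrite !mulrA => ? ? ? ? ?.
suff -> : gap n.+1 - gap n.+2 =
  ((1 - gap n.+1) * (gap n - gap n.+1) + (gap n - gap n.+1) * (1 - gap n)) / 2.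
  by lra.
by rewrite /=; field.
Qed.

Lemma picard_cauchy n m x : (n <= m)%N ->
  rnorm (Y m x - Y n x) <= gap n * rnorm x.
Proof.
move=> nm; suff : rnorm (Y m x - Y n x) <= (gap n - gap m) * rnorm x.
  have /andP[g0 _] := gap_itv m; have := rnorm_ge0 x; nra.
elim: m nm => [|m IHm].
  by rewrite leqn0 => /eqP->; rewrite !subrr mul0r rnorm0.
rewrite leq_eqVlt => /predU1P[->|/IHm nm]; first by rewrite !subrr mul0r rnorm0.
have := ler_rnormB_trans (Y m.+1 x) (Y m x) (Y n x).
have := picard_step m x; lra.
Qed.

(** The pointwise limit of the iterates. Every clause but the bound is an
    identity, and [Z] satisfies it up to a multiple of [gap n] for each [n]. *)
Lemma contraction_fixpoint : exists Z : H -> H, [/\ linear Z,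
  forall x, rnorm (Z x) <= rnorm x, forall x y, '[Z x, y] = '[x, Z y] &
  forall x, 2 *: Z x = B x + Z (Z x)].
Proof.
have [x|Z YZ] := @choice _ _ (fun x z =>
    forall n, rnorm (z - Y n x) <= gap n * rnorm x).
  apply: cauchy_rate => [eps eps0|n m]; last exact: picard_cauchy.
  have x1 : 0 < rnorm x + 1 by rewrite ltr_wpDl// rnorm_ge0.
  have [n gn] := gap_vanishing _ (divr_gt0 eps0 x1).
  exists n; move: gn; rewrite ltr_pdivlMr//.
  have /andP[g0 _] := gap_itv n; nra.
have eq_of_gap x (c : R) : 0 <= c -> (forall n, rnorm x <= c * gap n) -> x = 0.
  move=> c0 xc; apply: rnorm_eq0; apply/eqP; rewrite eq_le rnorm_ge0 andbT.
  exact: vanishing_le0 gap_vanishing c0 xc.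
have Zlin : linear Z.
  move=> a x y; apply/eqP; rewrite -subr_eq0; apply/eqP.
  pose c := rnorm (a *: x + y) + rnorm a * rnorm x + rnorm y.
  apply: (eq_of_gap _ c) => [|n].
    by rewrite !addr_ge0 ?mulr_ge0 ?rnorm_ge0.
  have -> : Z (a *: x + y) - (a *: Z x + Z y) =
      (Z (a *: x + y) - Y n (a *: x + y)) -
      (a *: (Z x - Y n x) + (Z y - Y n y)).
    by rewrite picard_linear scalerBr addrACA -opprD opprB addrA subrK.
  rewrite (le_trans (ler_rnormB _ _))//.
  have := YZ (a *: x + y) n; have := YZ y n.
  have := ler_rnormD (a *: (Z x - Y n x)) (Z y - Y n y); rewrite rnormZ.
  have := ler_wpM2l (rnorm_ge0 a) (YZ x n).
  rewrite /c; lra.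
have Zcontr x : rnorm (Z x) <= rnorm x.
  have := YZ x 0; rewrite /= subr0 mul1r//.
exists Z; split => // [x y|x].
  apply/eqP; rewrite -subr_eq0; apply/eqP/rnorm_eq0/eqP.
  rewrite eq_le rnorm_ge0 andbT.
  apply: (@vanishing_le0 _ gap _ (2 * (rnorm x * rnorm y))) => [||n].
  - exact: gap_vanishing.
  - by rewrite !mulr_ge0 ?rnorm_ge0.
  have -> : '[Z x, y] - '[x, Z y] = '[Z x - Y n x, y] - '[x, Z y - Y n y].
    by rewrite hdotBl hdotBr picard_sym; ring.
  rewrite (le_trans (ler_rnormB _ _))//.
  have := ler_hdot (Z x - Y n x) y; have := ler_hdot x (Z y - Y n y).
  have := ler_wpM2l (rnorm_ge0 x) (YZ y n).
  have := ler_wpM2r (rnorm_ge0 y) (YZ x n).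
  lra.
apply/eqP; rewrite -subr_eq0; apply/eqP.
apply: (eq_of_gap _ (4 * rnorm x)) => [|n].
  by rewrite mulr_ge0 ?rnorm_ge0.
have E : 2 *: Y n.+1 x = B x + Y n (Y n x).
  by rewrite /= scalerA divff ?pnatr_eq0// scale1r.
have -> : 2 *: Z x - (B x + Z (Z x)) = 2 *: (Z x - Y n.+1 x) -
     (Y n (Z x - Y n x) + (Z (Z x) - Y n (Z x))).
  rewrite picardB [Y n (Z x) - _ + _]addrC subrKA scalerBr E.
  by rewrite -[RHS]addrA -opprD -addrA subrKC.
rewrite (le_trans (ler_rnormB _ _))// rnormZ rnorm_nat.
have := ler_rnormD (Y n (Z x - Y n x)) (Z (Z x) - Y n (Z x)).
have /andP[g0 g1] := gap_itv n.
have gS : gap n.+1 <= gap n by rewrite /= gerBl divr_ge0// sqr_ge0.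
have := ler_wpM2r (rnorm_ge0 x) gS; have := ler_wpM2l g0 (Zcontr x).
have := mulr_ge0 g0 (rnorm_ge0 (Z x - Y n x)).
have := picard_le n (Z x - Y n x).
have := YZ (Z x) n; have := YZ x n.+1; have := YZ x n.
lra.
Qed.

End Contraction.
End SquareRoot.

Section OperatorAbs.
Context {R : realType} {H : hilbertSpace R}.
Implicit Types (x y z : H) (T : bounded_op H).
Local Notation "''[' x , y ]" := (hdot H x y) : ring_scope.

(** With [M] a bound for [T] and [A = T^* T], the operator [B = 1 - A / M^2] is
    a self-adjoint contraction: [|A x| <= M |T x|] yields
    [|B x|^2 <= |x|^2 - |T x|^2 / M^2]. The fixed point [Z] for [B] satisfies
    [(1 - Z)^2 = 1 - B = A / M^2], so [M (1 - Z)] is a square root of [A]; it is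
    positive because [Z] is a self-adjoint contraction. *)
Lemma opabs_exists T :
  exists S : bounded_op H, positive_op S /\ S ^+ 2 = adjoint T * T.
Proof.
have [M M0 TM] := bounded_op_bound T.
have AM := rnorm_formal_adjoint _ _ _ TM (hdot_adjointr T).
pose m : R := (M ^+ 2)^-1.
have m0 : 0 < m by rewrite invr_gt0 exprn_gt0.
have mM : m * M ^+ 2 = 1 by rewrite mulVf// gt_eqF// exprn_gt0.
pose A := adjoint T * T.
have Asym x y : '[A x, y] = '[x, A y].
  by rewrite !bopME hdot_adjointl hdot_adjointr.
pose B x := x - m%:C%C *: A x.
have [a x y|x|x y|Z [Zlin Zcontr Zsym ZB]] := @contraction_fixpoint _ H B.
- rewrite /B linearP scalerDr opprD scalerBr addrACA !scalerA.
  by rewrite [_ * a]mulrC.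
- rewrite -(@ler_pXn2r _ 2) ?nnegrE ?rnorm_ge0//.
  rewrite /B rnorm_sqrB hdotZr conjc_real.
  rewrite Re_realM rnormZ rnorm_real_complex (ger0_norm (ltW m0)) -Asym.
  rewrite bopME hdot_adjointl hdotxx /=.
  have := AM (T x); have := rnorm_ge0 (A x).
  rewrite -/(A x) -[adjoint T (T x)]/(A x) => a0 aM.
  have : rnorm (A x) ^+ 2 <= M ^+ 2 * rnorm (T x) ^+ 2.
    by rewrite -exprMn ler_pXn2r// nnegrE mulr_ge0 ?rnorm_ge0// ltW.
  move=> /(ler_wpM2l (ltW m0)).
  rewrite [m * (M ^+ 2 * _)]mulrA mM mul1r => /(ler_wpM2l (ltW m0)).
  have := mulr_ge0 (ltW m0) (sqr_ge0 (rnorm (T x))).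
  by rewrite exprMn; lra.
- by rewrite /B hdotBl hdotBr hdotZl hdotZr conjc_real Asym.
have ZD x y : Z (x - y) = Z x - Z y.
  by rewrite -scaleN1r addrC Zlin scaleN1r addrC.
have Z_Z a x : Z (a *: x) = a *: Z x.
  have Z0 : Z 0 = 0 by have := ZD 0 0; rewrite !subrr.
  by rewrite -[a *: x]addr0 Zlin Z0 addr0.
pose f x := M%:C%C *: (x - Z x).
have [||S Sf] := @exists_bounded_op _ H f (M * 2).
- move=> a x y; rewrite /f Zlin opprD addrACA -scalerBr scalerDr !scalerA.
  by rewrite [_ * a]mulrC.
- move=> x; rewrite rnormZ rnorm_real_complex ger0_norm ?(ltW M0)// -mulrA.
  rewrite ler_pM2l// (le_trans (ler_rnormB _ _))//; have := Zcontr x; lra.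
exists S; split.
  move=> x; rewrite Sf hdotZl hdotBl hdotxx mulr_ge0 ?lecR ?(ltW M0)//.
  have := Zsym x x; rewrite [RHS]hdotC => Zreal.
  have := ler_Re_hdot (Z x) x; have := ler_wpM2r (rnorm_ge0 x) (Zcontr x).
  case: '[Z x, x] Zreal => u v [vN] /= le1 le2.
  have -> : v = 0 by lra.
  by rewrite lecE /= !subr0 eqxx subr_ge0 expr2 (le_trans le2).
apply: bop_ext => x; rewrite expr2 bopME !Sf /f Z_Z ZD -scalerBr scalerA.
have -> : x - Z x - (Z x - Z (Z x)) = m%:C%C *: A x.
  have -> : x - Z x - (Z x - Z (Z x)) = x + Z (Z x) - 2 *: Z x.
    rewrite scaler_nat mulr2n !opprD opprK -!addrA; congr (x + _).
    by rewrite [RHS]addrC !addrA.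
  by rewrite ZB [B x + _]addrC addrKA /B subKr.
by rewrite scalerA -!rmorphM /= -expr2 mulrC mM scale1r.
Qed.

Lemma opabs_sqr T : opabs T ^+ 2 = adjoint T * T.
Proof. by have [_] := xgetPex 0 (opabs_exists T). Qed.

(** [|T|^4] is the square of the self-adjoint operator [T^* T]. *)
Lemma hdot_opabs4 T x :
  '[(opabs T ^+ 4) x, x] = (rnorm ((adjoint T * T) x) ^+ 2)%:C%C.
Proof.
rewrite (_ : 4 = 2 + 2)%N// exprD opabs_sqr -hdotxx bopME [LHS]hdot_adjointl.
by rewrite [LHS]hdot_adjointr.
Qed.
End OperatorAbs.

(** * Suprema over the unit sphere *)

Section Suprema.
Context {R : realType} {H : hilbertSpace R}.
Implicit Types (f : H -> R) (M : R) (x : H).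
Local Notation "''[' x , y ]" := (hdot H x y) : ring_scope.
Local Open Scope classical_set_scope.

Lemma ler_sup_sphere f M x : (forall y, `|y| = 1 -> f y <= M) ->
  `|x| = 1 -> f x <= sup [set f y | y in unit_sphere].
Proof.
move=> fM x1; apply: ub_le_sup; last by exists x.
by exists M => _ [y y1 <-]; exact: fM.
Qed.

(** [M] has to be nonnegative because the sphere of the zero space is empty. *)
Lemma sup_sphere_le f M : 0 <= M -> (forall y, `|y| = 1 -> f y <= M) ->
  sup [set f y | y in unit_sphere] <= M.
Proof.
move=> M0 fM; have [->|] := eqVneq [set f y | y in unit_sphere] set0.
  by rewrite sup0.
by move=> /set0P ne; apply: ge_sup => // _ [y y1 <-]; exact: fM.
Qed.

Lemma rnorm1 x : `|x| = 1 -> rnorm x = 1.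
Proof. by rewrite /rnorm => ->. Qed.

Lemma ler_opnorm (T : bounded_op H) x : `|x| = 1 -> rnorm (T x) <= opnorm T.
Proof.
have [M _ TM] := bounded_op_bound T; apply: (@ler_sup_sphere _ M) => y y1.
by rewrite (le_trans (TM y))// rnorm1// mulr1.
Qed.

Lemma ler_euclidean_opnorm d (T : 'I_d -> bounded_op H) x : `|x| = 1 ->
  Num.sqrt (\sum_(k < d) rnorm (T k x) ^+ 2) <= euclidean_opnorm T.
Proof.
apply: (@ler_sup_sphere _ (Num.sqrt (\sum_(k < d) opnorm (T k) ^+ 2))) => y y1.
apply/ler_wsqrtr/ler_sum => k _.
rewrite lerXn2r ?nnegrE ?rnorm_ge0 ?ler_opnorm//.
by rewrite (le_trans (rnorm_ge0 (T k y)))// ler_opnorm.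
Qed.

Lemma ler_euclidean_opradius d (T : 'I_d -> bounded_op H) x : `|x| = 1 ->
  Num.sqrt (\sum_(k < d) rnorm '[T k x, x] ^+ 2) <= euclidean_opradius T.
Proof.
apply: (@ler_sup_sphere _ (euclidean_opnorm T)) => y y1.
rewrite (le_trans _ (ler_euclidean_opnorm _ T _ y1))//.
apply/ler_wsqrtr/ler_sum => k _; rewrite lerXn2r ?nnegrE ?rnorm_ge0//.
by rewrite (le_trans (ler_hdot _ _))// (rnorm1 y)// mulr1.
Qed.

Lemma ler_sum_cauchy d (p q : 'I_d -> R) :
  \sum_(k < d) p k * q k <=
  Num.sqrt (\sum_(k < d) p k ^+ 2) * Num.sqrt (\sum_(k < d) q k ^+ 2).
Proof.
suff [] : [/\ 0 <= \sum_(k < d) p k ^+ 2, 0 <= \sum_(k < d) q k ^+ 2 &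
    \sum_(k < d) p k * q k <=
    Num.sqrt (\sum_(k < d) p k ^+ 2) * Num.sqrt (\sum_(k < d) q k ^+ 2)] by [].
elim/big_rec3: _ => [|k s v u _ [u0 v0 IH]]; first by rewrite sqrtr0 mulr0.
split; rewrite ?addr_ge0 ?sqr_ge0//.
rewrite (le_trans (_ : _ <= p k * q k + Num.sqrt u * Num.sqrt v)) ?lerD2l//.
rewrite -[leRHS]sqrtrM ?addr_ge0 ?sqr_ge0//.
rewrite (le_trans (ler_norm _))// -sqrtr_sqr.
apply: ler_wsqrtr; rewrite -{2}(sqr_sqrtr u0) -{2}(sqr_sqrtr v0).
(* Lagrange's identity for the two planar vectors [(p k, sqrt u)] and
   [(q k, sqrt v)]. *)
have := sqr_ge0 (p k * Num.sqrt v - q k * Num.sqrt u); nra.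
Qed.
End Suprema.

(** * The three upper bounds *)

Theorem corollary2p6 (R : realType) (H : hilbertSpace R) (d : nat)
    (d_ge1 : (1 <= d)%N) (B C : 'I_d -> bounded_op H) :
  [/\ euclidean_opradius (fun k => B k * C k) <=
        Num.sqrt (1 / 2 *
          opnorm (\sum_(k < d) (opabs (adjoint (B k)) ^+ 4 + opabs (C k) ^+ 4))),
      euclidean_opradius (fun k => B k * C k) <=
        Num.sqrt (1 / 2 * euclidean_opnorm (fun k => B k * adjoint (B k))
                        * euclidean_opnorm (fun k => adjoint (C k) * C k)
          + Num.sqrt d%:R / 2 *
            euclidean_opradius (fun k => B k * adjoint (C k * B k) * C k))
    & euclidean_opradius (fun k => B k * C k) <=
        Num.sqrt (1 / 4 *
            opnorm (\sum_(k < d) (opabs (adjoint (B k)) ^+ 4 + opabs (C k) ^+ 4))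
          + Num.sqrt d%:R / 2 *
            euclidean_opradius (fun k => B k * adjoint (C k * B k) * C k)) ].
Proof.
pose P k := adjoint (C k) * C k; pose Q k := B k * adjoint (B k).
pose p x k := rnorm (P k x); pose q x k := rnorm (Q k x).
pose c x k := rnorm (hdot H (P k x) (Q k x)).
(* [<B (C B)^* C x, x> = <C^* C x, B B^* x>] *)
have cE x k : c x k = rnorm (hdot H ((B k * adjoint (C k * B k) * C k) x) x).
  rewrite /c /P /Q !bopME [hdot H (B k _) x]hdot_adjointr.
  rewrite [hdot H (adjoint _ _) _ in RHS]hdot_adjointl.
  by rewrite [hdot H (adjoint (C k) _) _]hdot_adjointl !bopME.
(* [|<B C x, x>|^2 = |<C x, B^* x>|^2 <= |C x|^2 |B^* x|^2], and the last
   product is [<C^* C x, x> <x, B B^* x>]. *)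
have buz x k : `|x| = 1 ->
    rnorm (hdot H ((B k * C k) x) x) ^+ 2 <= (p x k * q x k + c x k) / 2.
  move=> x1; rewrite (le_trans _ (buzano _ _ _ (rnorm1 _ x1)))//.
  rewrite /P /Q !bopME [hdot H (adjoint (C k) _) _]hdot_adjointl.
  rewrite [hdot H (B k _) x]hdot_adjointr [hdot H x (B k _)]hdotC.
  rewrite [hdot H (B k _) x]hdot_adjointr rnorm_conj !hdotxx.
  rewrite !rnorm_real_complex.
  rewrite !ger0_norm ?sqr_ge0// -exprMn lerXn2r ?nnegrE ?mulr_ge0 ?rnorm_ge0//.
  exact: ler_hdot.
have cle x k : c x k <= p x k * q x k by exact: ler_hdot.
have pq2 x k : p x k * q x k <= (p x k ^+ 2 + q x k ^+ 2) / 2.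
  have := sqr_ge0 (p x k - q x k); rewrite sqrrB; lra.
pose S := \sum_(k < d) (opabs (adjoint (B k)) ^+ 4 + opabs (C k) ^+ 4).
have sumpq x : `|x| = 1 -> \sum_(k < d) (p x k ^+ 2 + q x k ^+ 2) <= opnorm S.
  move=> x1; rewrite (le_trans _ (ler_opnorm S x x1))//.
  have := ler_Re_hdot (S x) x; rewrite (rnorm1 _ x1) mulr1; apply: le_trans.
  rewrite (big_morph (fun T : bounded_op H => complex.Re (hdot H (T x) x))
     (id1 := 0) (op1 := +%R)) => [|S' T'|]; last first.
  - by rewrite linear0l.
  - by rewrite bopDE hdotDl ReD.
  apply: ler_sum => k _; rewrite bopDE hdotDl ReD !hdot_opabs4 adjointK /=.
  by rewrite addrC.
have sumc x : `|x| = 1 -> \sum_(k < d) c x k <= Num.sqrt d%:R *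
    euclidean_opradius (fun k => B k * adjoint (C k * B k) * C k).
  move=> x1; have := ler_sum_cauchy d (fun=> 1) (c x).
  under eq_bigr do rewrite mul1r.
  move=> /le_trans; apply.
  rewrite expr1n sumr_const card_ord ler_wpM2l ?sqrtr_ge0//.
  rewrite (le_trans _ (ler_euclidean_opradius _ _ x x1))//.
  by under eq_bigr do rewrite cE.
split; apply: sup_sphere_le (sqrtr_ge0 _) _ => x x1; apply: ler_wsqrtr.
- have := sumpq x x1.
  have : \sum_(k < d) rnorm (hdot H ((B k * C k) x) x) ^+ 2 <=
     \sum_(k < d) (p x k ^+ 2 + q x k ^+ 2) / 2.
    apply: ler_sum => k _.
    have := buz x k x1; have := cle x k; have := pq2 x k; lra.
  rewrite -mulr_suml; lra.
- have := sumc x x1.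
  have : \sum_(k < d) rnorm (hdot H ((B k * C k) x) x) ^+ 2 <=
     \sum_(k < d) (p x k * q x k + c x k) / 2.
    by apply: ler_sum => k _; exact: buz.
  rewrite -mulr_suml big_split /=.
  have := ler_sum_cauchy d (q x) (p x).
  have := ler_pM (sqrtr_ge0 _) (sqrtr_ge0 _) (ler_euclidean_opnorm d Q x x1)
     (ler_euclidean_opnorm d P x x1).
  under [X in _ -> X <= _ -> _]eq_bigr do rewrite mulrC.
  rewrite -/P -/Q -/(p x) -/(q x).
  lra.
- have := sumpq x x1; have := sumc x x1.
  have : \sum_(k < d) rnorm (hdot H ((B k * C k) x) x) ^+ 2 <=
     \sum_(k < d) ((p x k ^+ 2 + q x k ^+ 2) / 4 + c x k / 2).
    apply: ler_sum => k _; have := buz x k x1; have := pq2 x k; lra.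
  rewrite big_split /= -!mulr_suml; lra.
Qed.
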